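(* Let $\mathbb{F}$ be a field, let $n,k\in\mathbb{N}$ with $k<n-k$, and consider the block matrix $$A=\left(\begin{array}{c|c}\mathbf{0}_{k,k} & \mathbf{0}_{k,n-k}\\ \hline \mathbf{0}_{n-k,k} & A_{22}\end{array}\right)\in\mathbb{M}_n(\mathbb{F})$$ consisting of $k$ rows and columns of zeros and an invertible non-derogatory matrix $A_{22}\in\mathbb{M}_{n-k}(\mathbb{F})$. Then, if the field $\mathbb{F}$ has enough elements, there exists a square-zero matrix $N\in\mathbb{M}_n(\mathbb{F})$ such that $A+N$ is diagonalizable (with $n$ different eigenvalues).
   Context: $\mathbb{M}_m(\mathbb{F})$ is the ring of $m\times m$ matrices over $\mathbb{F}$, and $\mathbf{0}_{r,s}$ is the $r\times s$ zero matrix. A matrix $N$ is square-zero if $N^2=0$. A square matrix is non-derogatory if its minimal polynomial equals its characteristic polynomial. ''Enough elements'' is a condition on the number of elements of $\mathbb{F}$, for which no explicit bound is given. *)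

(* Defs.v *)
From mathcomp Require Import all_boot all_order all_algebra.

Set Implicit Arguments.
Unset Strict Implicit.
Unset Printing Implicit Defensive.

Import GRing.Theory.
Local Open Scope ring_scope.

Definition has_at_least (T : eqType) (b : nat) : Prop :=
  exists s : seq T, uniq s /\ (b <= size s)%N.

(* [mxminpoly] is only available in positive size; for the empty matrix the
   minimal and the characteristic polynomials are both 1. *)
Definition nonderogatory (F : fieldType) (m : nat) : 'M[F]_m -> Prop :=
  match m return 'M[F]_m -> Prop with
  | 0 => fun _ => True
  | m'.+1 => fun A => mxminpoly A = char_poly A
  end.

Definition square_zero (F : fieldType) (m : nat) (N : 'M[F]_m) : Prop :=
  N *m N = 0.

(* The eigenvalues are required to lie in the base field. *)
Definition has_distinct_eigenvalues (F : fieldType) (m : nat)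
    (A : 'M[F]_m) : Prop :=
  exists s : seq F, [/\ uniq s, size s = m & all (eigenvalue A) s].

(* Subtraction is truncated, but a strict bound below a difference still
   excludes [n < k]. *)
Lemma add_sub_dim (n k : nat) : (k < n - k)%N -> (k + (n - k))%N = n.
Proof.
by move=> lt_k; apply/subnKC/ltnW; rewrite -subn_gt0 (leq_ltn_trans _ lt_k).
Qed.

(* The cast only identifies the size [k + (n - k)] of the block matrix
   with [n]. *)
Definition zero_oplus (F : fieldType) (n k : nat) (ltkn : (k < n - k)%N)
    (A22 : 'M[F]_(n - k)) : 'M[F]_n :=
  castmx (add_sub_dim ltkn, add_sub_dim ltkn)
    (block_mx (0 : 'M[F]_(k, k)) (0 : 'M[F]_(k, n - k))
              (0 : 'M[F]_(n - k, k)) A22).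

(* Main.v *)
Require Import Defs.
From mathcomp Require Import all_boot all_order all_algebra.
From mathcomp Require Import zify.

Set Implicit Arguments.
Unset Strict Implicit.
Unset Printing Implicit Defensive.

Import GRing.Theory.
Local Open Scope ring_scope.

(** Write [B] for the invertible non-derogatory block, of size [m].

    The reduction is a single similarity.  For arbitrary [G : m x k] and
    [T : k x m], put [S = B^-1 G T G - G].  The matrix
    [N = (1; S) (- T S, T)] is square-zero because [(- T S, T) (1; S) = 0],
    and conjugating by a unipotent block matrix turns [(0 (+) B) + N] into the
    block triangular matrix with diagonal blocks [T G] and [B - G T].  This is
    where the invertibility of [B] enters, and it leaves the task of choosing
    [G] and [T] so that the spectra of [T G] and [B - G T] consist together of
    [n] distinct elements of the field ([square_zero_perturbation]).  The sum
    of these eigenvalues is forced to be the trace of [B].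

    A non-derogatory matrix has a cyclic vector [v].  In the basis of the
    vectors [v (B - d_0) ... (B - d_(i-1))], every row of [B] but the last is
    bidiagonal, with diagonal [d] that can be prescribed up to its sum, the
    trace ([nonderogatory_hessenberg]).  Cut this matrix as
    [(C, H12; H21, H22)] with [H22] of size [k].  Then [C] is upper bidiagonal,
    and [H22 = X + Y] where [Y] is upper bidiagonal and [X] is lower
    triangular, since [Y] absorbs the superdiagonal of [H22].  The diagonals of
    [C], [X] and [Y] are arbitrary apart from the trace condition.  The choice
    [T = (0, 1)], [G = (H12; X)] gives [T G = X] and
    [B - G T = (C, 0; H21, Y)], so the spectrum consists of these three
    diagonals ([nonderogatory_split]).

    What remains is to find [n >= 3] distinct scalars with a given sum, which a
    field with at least [2 n] elements allows ([uniq_with_sum]). *)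

(** * Characteristic polynomials of similar and triangular matrices *)

Lemma char_poly_similar (F : fieldType) (n : nat) (P A B : 'M[F]_n) :
  P \in unitmx -> P *m A = B *m P -> char_poly A = char_poly B.
Proof.
move=> Punit PA; pose Q := map_mx (@polyC F) P.
have detQ : \det Q != 0.
  by rewrite det_map_mx polyC_eq0 -unitfE -unitmxE.
apply: (mulfI detQ); rewrite [RHS]mulrC -!det_mulmx; congr (\det _).
by rewrite mulmxBr mulmxBl -!map_mxM PA scalar_mxC.
Qed.

Lemma char_poly_block_utrig (F : fieldType) (m1 m2 : nat) (A : 'M[F]_m1)
    (B : 'M_(m1, m2)) (C : 'M_m2) :
  char_poly (block_mx A B 0 C) = char_poly A * char_poly C.
Proof.
rewrite /char_poly /char_poly_mx map_block_mx map_mx0 scalar_mx_block.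
by rewrite opp_block_mx add_block_mx !add0r oppr0 det_ublock.
Qed.

Lemma char_poly_tr (F : fieldType) (n : nat) (A : 'M[F]_n) :
  char_poly A^T = char_poly A.
Proof.
rewrite /char_poly -[RHS]det_tr; congr (\det _); apply/matrixP=> i j.
by rewrite !mxE eq_sym.
Qed.

Lemma char_poly_block_ltrig (F : fieldType) (m1 m2 : nat) (A : 'M[F]_m1)
    (B : 'M_(m2, m1)) (C : 'M_m2) :
  char_poly (block_mx A 0 B C) = char_poly A * char_poly C.
Proof.
by rewrite -char_poly_tr tr_block_mx trmx0 char_poly_block_utrig !char_poly_tr.
Qed.

Lemma char_poly_utrig (F : fieldType) (n : nat) (A : 'M[F]_n) :
  (forall i j : 'I_n, (j < i)%N -> A i j = 0) ->
  char_poly A = \prod_i ('X - (A i i)%:P).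
Proof.
move=> A0; rewrite -char_poly_tr char_poly_trig.
  by apply: eq_bigr => i _; rewrite mxE.
by apply/is_trig_mxP => i j ltij; rewrite mxE A0.
Qed.

(** * Perturbation by a square-zero matrix *)

(** The perturbation exchanges the spectrum of [0 (+) B] for those of [T G]
    and [B - G T]. *)
Lemma square_zero_perturbation (F : fieldType) (k m : nat) (B : 'M[F]_m)
    (G : 'M_(m, k)) (T : 'M_(k, m)) :
  B \in unitmx ->
  exists2 N : 'M_(k + m), square_zero N &
    char_poly (block_mx 0 0 0 B + N) =
    char_poly (T *m G) * char_poly (B - G *m T).
Proof.
move=> Bu.
(* [N] is the outer product of [(1; S)] by [(- T S, T)]; conjugating by
   [(1, 0; - S, 1)] makes [N] strictly upper block triangular, then [(1, 0; - G, 1)]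
   makes the sum block triangular.  [Z] is the product of the two. *)
pose L := invmx B *m (G *m (T *m G)); pose S := L - G.
exists (block_mx (- (T *m S)) T (- (S *m (T *m S))) (S *m T)).
  rewrite /square_zero mulmx_block !mulmxN !mulNmx !opprK -!mulmxA.
  rewrite !subrr ?addNr.
  by rewrite block_mx0.
pose Z : 'M_(k + m) := block_mx 1%:M 0 (- L) 1%:M.
have Zu : Z \in unitmx by rewrite unitmxE det_lblock !det1 mulr1 unitr1.
rewrite (char_poly_similar (B := block_mx (T *m G) T 0 (B - G *m T)) Zu).
  exact: char_poly_block_utrig.
rewrite add_block_mx !add0r !mulmx_block !mul0mx !mul1mx !mulmx0 !mulmx1.
rewrite !add0r !addr0.
have BL : B *m L = G *m (T *m G) by rewrite mulKVmx.
congr block_mx.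
- by rewrite /S mulmxBr opprB mulmxN.
- rewrite mulmxN mulNmx opprK -mulmxBl /S opprB addrCA subrr addr0.
  by rewrite mulmxN mulmxBl BL opprB -mulmxA mulmxBr mulmxBr.
by rewrite mulNmx addrCA -mulNmx -mulmxDl /S addrA addNr add0r mulNmx.
Qed.

(** * Cyclic vectors of non-derogatory matrices *)

Section Cyclic.
Variables (F : fieldType) (n' : nat).
Local Notation n := n'.+1.
Variable B : 'M[F]_n.

(** The ideal of polynomials [q] such that [v q(B) = 0] is the principal ideal
    of [f]. *)
Definition annihilator (v : 'rV[F]_n) (f : {poly F}) :=
  forall q, (v *m horner_mx B q == 0) = (f %| q).

Lemma mul_rows_horner d (v : 'rV_n) (p : 'I_d -> {poly F}) (u : 'rV_d) :
  u *m \matrix_i (v *m horner_mx B (p i)) =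
  v *m horner_mx B (\sum_i u 0 i *: p i).
Proof.
rewrite mulmx_sum_row linear_sum mulmx_sumr; apply: eq_bigr => i _.
by rewrite rowK linearZ /= scalemxAr.
Qed.

Lemma mul_hornerM (v : 'rV_n) p q :
  v *m horner_mx B (p * q) = v *m horner_mx B p *m horner_mx B q.
Proof. by rewrite rmorphM /= -mulmxA. Qed.

(** Descent on a polynomial [q] killing [v]: either the vectors [v B^i] for
    [i < deg q] are independent, so that no nonzero remainder modulo [q] kills
    [v], or a dependency among them is a killing polynomial of lower degree. *)
Lemma annihilator_exists v : exists f, annihilator v f.
Proof.
suff killer s (q : {poly F}) : (size q <= s)%N -> q != 0 ->
    v *m horner_mx B q = 0 -> exists f, annihilator v f.
  apply: (killer _ (char_poly B) (leqnn _)).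
    by rewrite -size_poly_gt0 size_char_poly.
  by rewrite Cayley_Hamilton mulmx0.
elim: s q => [|s IHs] q; first by rewrite leqn0 size_poly_eq0 => /eqP-> /eqP.
move=> le_qs q0 vq.
pose K := \matrix_(i < (size q).-1) (v *m horner_mx B 'X^i).
have KE (u : 'rV_(size q).-1) : u *m K = v *m horner_mx B (rVpoly u).
  by rewrite mul_rows_horner [rVpoly u]poly_def; congr (_ *m horner_mx _ _);
    apply: eq_bigr => i _; rewrite valK.
have [/eqP | /rowV0Pn[u /sub_kermxP uK u0]] := eqVneq (kermx K) 0; last first.
  apply: (IHs (rVpoly u)); last by rewrite -KE.
    by rewrite (leq_trans (size_poly _ _)) // -ltnS prednK ?size_poly_gt0.
  by apply: contraNneq u0 => u0; rewrite -[u]rVpolyK u0 linear0.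
rewrite kermx_eq0 => freeK; exists q => r.
have -> : v *m horner_mx B r = v *m horner_mx B (r %% q).
  by rewrite {1}(divp_eq r q) mulrC rmorphD mulmxDr /= mul_hornerM vq
    mul0mx add0r.
have lt_rq : (size (r %% q)%R <= (size q).-1)%N.
  by rewrite -ltnS prednK ?size_poly_gt0 // ltn_modp.
rewrite -(poly_rV_K lt_rq) -KE mulmx_free_eq0 //.
by rewrite -(inj_eq (can_inj (@rVpolyK _ _))) poly_rV_K // linear0.
Qed.

Lemma annihilator0 : annihilator 0 1.
Proof. by move=> q; rewrite mul0mx eqxx dvd1p. Qed.

Lemma annihilator_neq0 v f : annihilator v f -> f != 0.
Proof.
move=> annf; have := annf (char_poly B); rewrite Cayley_Hamilton mulmx0 eqxx.
by move=> /esym /dvdpN0; apply; rewrite -size_poly_gt0 size_char_poly.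
Qed.

Lemma annihilator_divisor v f c :
  annihilator v (c * f) -> annihilator (v *m horner_mx B c) f.
Proof.
move=> ann q; have := annihilator_neq0 ann; rewrite mulf_eq0 negb_or.
by case/andP=> c0 _; rewrite -mul_hornerM ann dvdp_mul2l.
Qed.

(** If [q] kills [v + w] then [q g] kills [v], as [g] kills [w]; hence [f]
    divides [q g], and so [q] by coprimality. *)
Lemma annihilator_coprime v w f g :
  coprimep f g -> annihilator v f -> annihilator w g ->
  annihilator (v + w) (f * g).
Proof.
have half v1 w1 f1 g1 q : coprimep f1 g1 -> annihilator v1 f1 ->
    annihilator w1 g1 -> (v1 + w1) *m horner_mx B q = 0 -> f1 %| q.
  move=> cop ann1 ann2 vw0; rewrite -(Gauss_dvdpl _ cop) -ann1.
  have wg0 : w1 *m horner_mx B (q * g1) = 0.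
    by apply/eqP; rewrite ann2 dvdp_mulIr.
  have -> : v1 *m horner_mx B (q * g1) = (v1 + w1) *m horner_mx B (q * g1).
    by rewrite mulmxDl wg0 addr0.
  by rewrite mul_hornerM vw0 mul0mx.
move=> cop annv annw q; rewrite Gauss_dvdp //.
apply/eqP/andP => [vw0 | [fq gq]].
  split; first exact: (half v w f g).
  by apply: (half w v g f); rewrite 1?coprimep_sym // addrC.
by move: fq gq; rewrite mulmxDl -annv -annw => /eqP-> /eqP->; rewrite addr0.
Qed.

End Cyclic.

(** The least common multiple as a product of coprime divisors, without
    factoring into irreducibles: [f1] keeps the part of [f] that involves only
    primes foreign to [h = g / gcd(f, g)], which are the primes where [f] has
    at least the multiplicity of [g]; the other primes go to [g1]. *)
Lemma lcm_coprime_split (F : fieldType) (f g : {poly F}) :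
  f != 0 -> g != 0 ->
  exists f1 g1, [/\ f1 %| f, g1 %| g, coprimep f1 g1 &
                    (f %| f1 * g1) /\ (g %| f1 * g1)].
Proof.
move=> f0 g0; pose e := gcdp f g.
have e0 : e != 0 by rewrite gcdp_eq0 negb_and f0.
pose h := g %/ e; pose k := f %/ e.
have fE : f = k * e by rewrite divpK // dvdp_gcdl.
have gE : g = h * e by rewrite divpK // dvdp_gcdr.
have cop_kh : coprimep k h by rewrite coprimep_div_gcd ?f0.
case: (gdcopP h f) => f1 f1f.
rewrite (negPf f0) orbF => cop_f1h f1max.
have f10 : f1 != 0 by exact: dvdpN0 f1f f0.
pose c := f %/ f1; have cE : f = f1 * c by rewrite divpKC.
(* A common divisor [d] of [a] and [c] is foreign to [h], so the maximality of
   [f1] applies to [d * f1] and makes [d] constant. *)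
have cop_c a : coprimep a h -> coprimep a c.
  move=> cop_ah; rewrite coprimep_def -(size_poly1 F).
  pose d := gcdp a c.
  have : d * f1 %| f1.
    apply: f1max; first by rewrite cE mulrC dvdp_mul2l // dvdp_gcdr.
    by rewrite coprimepMl cop_f1h andbT (coprimep_dvdr (dvdp_gcdl a c)).
  by rewrite -{2}[f1]mul1r dvdp_mul2r // dvdp1 => /eqP->; rewrite size_poly1.
exists f1, (c * h); split => //.
- have : c * h %| k * g.
    by rewrite gE mulrCA -fE cE mulrCA [h * c]mulrC dvdp_mulIr.
  by rewrite Gauss_dvdpr // coprimep_sym coprimepMr cop_c.
- by rewrite coprimepMr cop_c.
split; first by rewrite mulrA -cE dvdp_mulIl.
by rewrite mulrA -cE fE -mulrA [e * h]mulrC -gE dvdp_mulIr.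
Qed.

(** Applied to a spanning family, this yields a vector whose annihilator is
    that of the whole space, the minimal polynomial of [B]. *)
Lemma annihilator_common (F : fieldType) (n' : nat) (B : 'M[F]_n'.+1)
    (ws : seq 'rV_n'.+1) :
  exists v f, annihilator B v f /\
    forall w, w \in ws -> w *m horner_mx B f = 0.
Proof.
elim: ws => [|w ws [v [f [annv killf]]]].
  by exists 0, 1; split=> //; exact: annihilator0.
have [g annw] := annihilator_exists B w.
have [f1 [g1 [/dvdpP[c fE] /dvdpP[d gE] cop [f_fg g_fg]]]] :=
  lcm_coprime_split (annihilator_neq0 annv) (annihilator_neq0 annw).
exists (v *m horner_mx B c + w *m horner_mx B d), (f1 * g1); split.
  by apply: annihilator_coprime => //; apply: annihilator_divisor;
    rewrite -?fE -?gE.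
move=> x; rewrite inE => /orP[/eqP-> | /killf xf0].
  by apply/eqP; rewrite annw.
by case/dvdpP: f_fg => r ->; rewrite mulrC mul_hornerM xf0 mul0mx.
Qed.

(** A vector whose annihilator is the minimal polynomial is cyclic as soon as
    this polynomial has degree the size of [B]. *)
Lemma nonderogatory_cyclic (F : fieldType) (n' : nat) (B : 'M[F]_n'.+1) :
  nonderogatory B -> exists v : 'rV_n'.+1,
    forall q : {poly F}, (size q <= n'.+1)%N -> v *m horner_mx B q = 0 -> q = 0.
Proof.
move=> /= minB.
have [v [f [annv kill]]] :=
  annihilator_common B [seq row i (1%:M : 'M_n'.+1) | i <- enum 'I_n'.+1].
exists v => q le_q /eqP; rewrite annv => f_q.
have f0 : horner_mx B f = 0.
  apply/row_matrixP => i; rewrite row0 -[horner_mx B f]mul1mx row_mul.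
  by apply: kill; apply/map_f; rewrite mem_enum.
apply: contraTeq le_q => q0; rewrite -ltnNge -(size_char_poly B) -minB.
by apply: dvdp_leq => //; apply: dvdp_trans f_q; apply: mxminpoly_min.
Qed.

(** * Normal forms of non-derogatory matrices *)

(** The basis is [v p_i(B)] with [p_i = (X - d_0) ... (X - d_(i-1))]: the
    relation [X p_i = d_i p_i + p_(i+1)] gives the rows other than the last, and
    the last diagonal entry is what the trace leaves. *)
Lemma nonderogatory_hessenberg (F : fieldType) (m : nat) (B : 'M[F]_m)
    (d : nat -> F) :
  nonderogatory B -> \sum_(i < m) d i = \tr B ->
  exists P H : 'M_m, [/\ P \in unitmx, P *m B = H *m P,
    forall i, H i i = d i &
    forall i j : 'I_m, (i.+1 < m)%N -> i != j -> H i j = (j == i.+1 :> nat)%:R].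
Proof.
case: m B => [|n'] B nonderB sum_d.
  by exists 1%:M, B; split; rewrite ?unitmx1 ?mul1mx ?mulmx1 // => -[].
have [v cyclic_v] := nonderogatory_cyclic nonderB.
pose p i : {poly F} := \prod_(a <- mkseq d i) ('X - a%:P).
have size_p i : size (p i) = i.+1 by rewrite size_prod_XsubC size_mkseq.
(* The passage from the powers of [X] to the [p_i] is unitriangular. *)
pose N := \matrix_(i < n'.+1, j < n'.+1) (p i)`_j.
have Nu : N \in unitmx.
  rewrite unitmxE det_trig; last first.
    by apply/is_trig_mxP => i j lt_ij; rewrite mxE nth_default ?size_p.
  rewrite big1 ?unitr1 // => i _; rewrite mxE.
  have /monicP := monic_prod_XsubC (mkseq d i) xpredT id.
  by rewrite /lead_coef size_p.
pose P := \matrix_(i < n'.+1) (v *m horner_mx B (p i)).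
have Pu : P \in unitmx.
  rewrite -row_free_unit; apply: inj_row_free => u; rewrite mul_rows_horner.
  move/cyclic_v => up0; apply: (can_inj (mulmxK Nu)); rewrite mul0mx.
  apply/rowP=> j; rewrite !mxE -[RHS](coef0 F j) -up0 ?coef_sum.
    by apply: eq_bigr => i _; rewrite mxE coefZ.
  apply: leq_trans (size_sum _ _ _) _; apply/bigmax_leqP => i _.
  by rewrite (leq_trans (size_scale_leq _ _)) ?size_p.
have [H HE] : exists H, H = P *m B *m invmx P by exists (P *m B *m invmx P).
have PB : P *m B = H *m P by rewrite HE mulmxKV.
have Hrow (i j : 'I_n'.+1) : (i.+1 < n'.+1)%N ->
    H i j = d i *+ (i == j) + (j == i.+1 :> nat)%:R.
  move=> lt_i; have -> : H i j = row i H 0 j by rewrite mxE.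
  pose i1 := Ordinal lt_i.
  have -> : row i H = d i *: row i 1%:M + row i1 1%:M.
    rewrite HE -(mulmxV Pu) !row_mul scalemxAl -mulmxDl; congr (_ *m _).
    rewrite !rowK /= /p mkseqS -cats1 big_cat big_seq1 /=.
    rewrite mulrBr rmorphB /= mulmxBr mul_hornerM horner_mx_X addrC.
    by rewrite [_ * (d i)%:P]mulrC mul_polyC horner_mxZ -scalemxAr subrK.
  by rewrite !mxE mulr_natr [j == i1 :> nat]eq_sym.
have Hdiag (i : 'I_n'.+1) : (i.+1 < n'.+1)%N -> H i i = d i.
  by move/Hrow->; rewrite eqxx ltn_eqF ?addr0.
have Hlast : H ord_max ord_max = d n'.
  have : \tr H = \tr B by rewrite HE mxtrace_mulC mulmxA mulVmx ?mul1mx.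
  rewrite -sum_d /mxtrace !big_ord_recr /= => eq_sum.
  apply: (addrI (\sum_(i < n') d i)); rewrite -eq_sum; congr (_ + _).
  by apply: eq_bigr => i _; rewrite Hdiag //= ltnS.
exists P, H; split=> // [i|i j lt_i /negPf ne_ij].
  have [lt_in|] := ltnP i n'; first exact: Hdiag.
  move=> le_ni; have -> : i = ord_max.
    by apply/val_inj/eqP; rewrite eqn_leq le_ni -ltnS ltn_ord.
  exact: Hlast.
by rewrite Hrow // ne_ij add0r.
Qed.

(** The first [l] values of [a] are the diagonal of [C], the next [k] that of
    [X] and the last [k] that of [Y]. *)
Lemma nonderogatory_split (F : fieldType) (l k : nat) (B : 'M[F]_(l + k))
    (a : nat -> F) :
  (0 < k)%N -> nonderogatory B -> \sum_(i < l + k + k) a i = \tr B ->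
  exists (G : 'M_(l + k, k)) (T : 'M_(k, l + k)),
    char_poly (T *m G) * char_poly (B - G *m T) =
    \prod_(i < l + k + k) ('X - (a i)%:P).
Proof.
move=> k0 nonderB sum_a.
pose d i := if (i < l)%N then a i else a i + a (k + i)%N.
have sum_d : \sum_(i < l + k) d i = \tr B.
  rewrite -sum_a !big_split_ord /= -addrA -big_split /=; congr (_ + _).
    by apply: eq_bigr => i _; rewrite /d ltn_ord.
  by apply: eq_bigr => i _; rewrite /d ltnNge leq_addr addnCA addnA.
have [P [H [Pu PB Hdiag Hoff]]] := nonderogatory_hessenberg nonderB sum_d.
pose Y : 'M[F]_k := \matrix_(i, j)
  if i == j then a (l + k + i)%N else (j == i.+1 :> nat)%:R.
pose X := drsubmx H - Y.
pose G := col_mx (ursubmx H) X.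
pose T : 'M[F]_(k, l + k) := row_mx 0 1%:M.
have TG : T *m G = X by rewrite mul_row_col mul0mx mul1mx add0r.
have HGT : H - G *m T = block_mx (ulsubmx H) 0 (dlsubmx H) Y.
  rewrite mul_col_row !mulmx0 !mulmx1 -{1}[H]submxK opp_block_mx add_block_mx.
  by rewrite !subr0 subrr /X opprB addrC subrK.
exists (invmx P *m G), (T *m P).
rewrite mulmxA mulmxK // TG.
have -> : char_poly (B - invmx P *m G *m (T *m P)) = char_poly (H - G *m T).
  apply: (char_poly_similar Pu); rewrite mulmxBr mulmxBl PB.
  by rewrite -!mulmxA mulKVmx.
(* Reorder the factors as [C], [X], [Y]. *)
rewrite HGT char_poly_block_ltrig mulrCA !big_split_ord /= -mulrA.
congr (_ * (_ * _)).
- rewrite char_poly_utrig => [|i j lt_ji].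
    apply: eq_bigr => i _; rewrite !mxE Hdiag /d /= ltn_ord //.
  rewrite !mxE Hoff /=.
  + by rewrite ltn_eqF // ltnS ltnW.
  + by have := ltn_ord i; lia.
  by rewrite -val_eqE /= gtn_eqF.
- rewrite char_poly_trig.
    apply: eq_bigr => i _; rewrite !mxE Hdiag eqxx /d /= ltnNge leq_addr /=.
    by rewrite addnCA addnA addrK.
  apply/is_trig_mxP => i j lt_ij; rewrite !mxE.
  have /negPf-> : i != j by apply: contraTneq lt_ij => ->; rewrite ltnn.
  (* The superdiagonal ones of [H22] and [Y] cancel, and a row with an
     entry strictly above the diagonal is not the last one. *)
  rewrite Hoff /= -?addnS ?eqn_add2l ?subrr //.
    by rewrite leq_add2l (leq_ltn_trans lt_ij).
  by rewrite -val_eqE /= eqn_add2l ltn_eqF.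
rewrite char_poly_utrig => [|i j lt_ji].
  by apply: eq_bigr => i _; rewrite mxE eqxx.
by rewrite mxE -val_eqE /= gtn_eqF // ltn_eqF // ltnS ltnW.
Qed.

(** * Distinct scalars with a prescribed sum *)

Lemma exists_notin (T : eqType) (b : nat) (s : seq T) :
  has_at_least T b -> (size s < b)%N -> exists x, x \notin s.
Proof.
move=> [r [uniq_r le_br]] lt_sb.
have [/allP sub_rs | /allPn[x _ xs]] := boolP (all (mem s) r); last by exists x.
by have := leq_trans le_br (uniq_leq_size uniq_r sub_rs); rewrite leqNgt lt_sb.
Qed.

(** The last two scalars are [x] and [c - x], where [c] is what the others
    leave of the sum.  They are distinct when [2 x <> c]; in
    characteristic 2 this asks for [c <> 0], so the third scalar [z] is first
    chosen to ensure it, which is why [n > 2]. *)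
Lemma uniq_with_sum (F : fieldType) (n : nat) (t : F) :
  (2 < n)%N -> has_at_least F n.*2 ->
  exists s : seq F, [/\ uniq s, size s = n & \sum_(x <- s) x = t].
Proof.
case: n => [|[|[|n]]] // _ bigF.
have [s0 [uniq_s0 size_s0]] := bigF.
pose r := take n s0.
have size_r : size r = n.
  by rewrite size_takel // (leq_trans _ size_s0) //; lia.
have [z] : exists z, z \notin t - \sum_(x <- r) x :: r.
  by apply: (exists_notin bigF); rewrite /= size_r doubleS !ltnS -addnn; lia.
rewrite inE negb_or => /andP[z_sum zr].
pose c := t - \sum_(x <- z :: r) x.
have c0 : c != 0 by rewrite /c big_cons opprD addrCA addrC subr_eq0 eq_sym.
(* In characteristic 2 the quotient [c / 2%:R] is [0], a harmless exclusion. *)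
have [x] : exists x, x \notin c / 2%:R :: (z :: r) ++ [seq c - y | y <- z :: r].
  by apply: (exists_notin bigF); rewrite /= size_cat /= size_map size_r; lia.
rewrite in_cons mem_cat 2!negb_or => /and3P[x_half x_r x_cr].
exists [:: x, c - x, z & r]; split.
- rewrite cons_uniq in_cons negb_or x_r andbT cons_uniq.
  apply/and3P; split.
  + apply: contraNneq x_half => x_cx.
    have c2x : c = x * 2%:R by rewrite mulr_natr mulr2n {2}x_cx addrC subrK.
    have two0 : 2%:R != 0 :> F.
      by apply: contraNneq c0 => two0; rewrite c2x two0 mulr0.
    by rewrite {1}c2x mulfK.
  + by apply: contra x_cr => cx_r; apply/mapP; exists (c - x); rewrite ?subKr.
  by rewrite /= zr take_uniq.
- by rewrite /= size_r.
by rewrite 2!big_cons addrA [x + _]addrC subrK /c subrK.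
Qed.

(** * Conclusion *)

Lemma distinct_roots_diagonalizable (F : fieldType) (n : nat) (A : 'M[F]_n.+1)
    (s : seq F) :
  uniq s -> size s = n.+1 -> char_poly A = \prod_(x <- s) ('X - x%:P) ->
  diagonalizable A /\ has_distinct_eigenvalues A.
Proof.
move=> uniq_s size_s charA; split.
  by apply/diagonalizableP; exists s; rewrite // -charA mxminpoly_dvd_char.
exists s; split=> //; apply/allP => x xs.
by rewrite eigenvalue_root_char charA root_prod_XsubC.
Qed.

(** The size is a variable [n] equal to [k + m], so that the cast disappears by
    elimination of the equality. *)
Lemma zero_block_perturbation (F : fieldType) (n k m : nat)
    (eq_n : (k + m)%N = n) (B : 'M[F]_m) :
  (0 < k)%N -> (k < m)%N -> has_at_least F n.*2 ->
  B \in unitmx -> nonderogatory B ->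
  exists N : 'M[F]_n,
    [/\ square_zero N,
        diagonalizable (castmx (eq_n, eq_n) (block_mx 0 0 0 B) + N) &
        has_distinct_eigenvalues (castmx (eq_n, eq_n) (block_mx 0 0 0 B) + N)].
Proof.
move=> k0 lt_km; case: n / eq_n => bigF Bu nonderB; rewrite castmx_id.
have [s [uniq_s size_s sum_s]] : exists s : seq F,
    [/\ uniq s, size s = (k + m)%N & \sum_(x <- s) x = \tr B].
  by apply: uniq_with_sum bigF; lia.
have [N N2 charN] : exists2 N : 'M[F]_(k + m), square_zero N &
    char_poly (block_mx 0 0 0 B + N) = \prod_(x <- s) ('X - x%:P).
  move: lt_km B Bu nonderB sum_s size_s => /ltnW/subnK <-; move: (m - k)%N => l.
  move=> B Bu nonderB sum_s size_s.
  have size_s' : size s = (l + k + k)%N by rewrite size_s addnC.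
  have [|G [T GT]] := @nonderogatory_split _ l k B (nth 0 s) k0 nonderB.
    by rewrite -sum_s (big_nth 0) big_mkord size_s'.
  have [N N2 charN] := square_zero_perturbation G T Bu; exists N => //.
  by rewrite charN GT (big_nth 0) big_mkord size_s'.
exists N; move: k0 N N2 charN.
case: k {bigF} lt_km size_s => // k _ size_s _ N N2 charN.
by have [] := distinct_roots_diagonalizable uniq_s size_s charN.
Qed.

Theorem corollary3p1 (n k : nat) (hk : (0 < k)%N) (hkn : (k < n - k)%N) :
  exists b : nat, forall F : fieldType, has_at_least F b ->
  forall A22 : 'M[F]_(n - k), A22 \in unitmx -> nonderogatory A22 ->
  exists N : 'M[F]_n,
    [/\ square_zero N,
        diagonalizable (zero_oplus hkn A22 + N) &
        has_distinct_eigenvalues (zero_oplus hkn A22 + N)].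
Proof.
exists n.*2 => F bigF A22; exact: zero_block_perturbation.
Qed.
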